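(* The variety of pseudo equality algebras is subtractive.
   Context: A pseudo equality algebra is an algebra $(X;\sim,\backsim,\wedge,1)$ of type $(2,2,2,0)$ such that for all $a,b,c\in X$ (with $x\le y$ iff $x\wedge y=x$): (F1) $(X;\wedge,1)$ is a meet-semilattice with top element $1$; (F2) $a\sim a=1=a\backsim a$; (F3) $a\sim 1=a=1\backsim a$; (F4) $a\leq b\leq c$ implies $a\sim c\leq b\sim c$, $a\sim c\leq a\sim b$, $c\backsim a\leq c\backsim b$ and $c\backsim a\leq b\backsim a$; (F5) $a\sim b\leq (a\wedge c)\sim (b\wedge c)$ and $a\backsim b\leq (a\wedge c)\backsim (b\wedge c)$; (F6) $a\sim b\leq (c\sim a)\backsim (c\sim b)$ and $a\backsim b\leq (a\backsim c)\sim (b\backsim c)$; (F7) $a\sim b\leq (a\sim c)\sim (b\sim c)$ and $a\backsim b\leq (c\backsim a)\backsim (c\backsim b)$. These algebras form a variety, since (F4) can be rewritten by inequalities between terms. A variety is subtractive if it satisfies the identities $S(x,x)=0$ and $S(x,0)=x$ for some binary term $S$ and some nullary term $0$ in its language. *)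

(* Defs.v *)
From mathcomp Require Import all_boot.

Set Implicit Arguments.
Unset Strict Implicit.
Unset Printing Implicit Defensive.

Record signature := Signature { symbol : Type; arity : symbol -> nat }.

Record algebra (L : signature) := Algebra {
  carrier :> Type;
  op : forall f : symbol L, (arity f).-tuple carrier -> carrier }.

Arguments op {L} a f _.

(* The arguments of a symbol are a finite function rather than a tuple because
   [n.-tuple (term V)] is not strictly positive. *)
Inductive term (L : signature) (V : Type) :=
| Var of V
| App (f : symbol L) of {ffun 'I_(arity f) -> term L V}.

Arguments Var {L V} _.
Arguments App {L V} f _.

Fixpoint eval (L : signature) (A : algebra L) (V : Type) (v : V -> A)
    (t : term L V) : A :=
  match t with
  | Var x => v x
  | App f args => op A f [tuple eval v (args i) | i < arity f]
  end.

Fixpoint subst (L : signature) (V W : Type) (s : V -> term L W)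
    (t : term L V) : term L W :=
  match t with
  | Var x => s x
  | App f args => App f [ffun i => subst s (args i)]
  end.

(* An [n]-ary term is a term in the variables [0, ..., n - 1]. *)
Definition nary_term (L : signature) (n : nat) := term L 'I_n.

Definition tinst (L : signature) (n : nat) (t : nary_term L n)
    (s : n.-tuple (term L nat)) : term L nat :=
  subst (tnth s) t.

Record identity (L : signature) := Identity { lhs : term L nat; rhs : term L nat }.

Declare Scope ualg_scope.
Delimit Scope ualg_scope with U.
Local Open Scope ualg_scope.

Notation "s =~ t" := (Identity s t) (at level 70, no associativity) : ualg_scope.

Definition satisfies (L : signature) (A : algebra L) (e : identity L) : Prop :=
  forall v : nat -> A, eval v (lhs e) = eval v (rhs e).

Definition equational_class (L : signature) (E : identity L -> Prop)
    (A : algebra L) : Prop :=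
  forall e, E e -> satisfies A e.

Record variety (L : signature) := Variety {
  in_variety :> algebra L -> Prop;
  varietyP : exists E : identity L -> Prop,
    forall A, in_variety A <-> equational_class E A }.

Definition variety_satisfies (L : signature) (K : variety L) (e : identity L) :
    Prop :=
  forall A : algebra L, K A -> satisfies A e.

Definition subtractive (L : signature) (K : variety L) : Prop :=
  exists (S : nary_term L 2) (O : nary_term L 0),
    let x := Var 0 in
    let zero := tinst O [tuple] in
    variety_satisfies K (tinst S [tuple x; x] =~ zero) /\
    variety_satisfies K (tinst S [tuple x; zero] =~ x).

Inductive peq_symbol := Sim | Bsim | Meet | One.

Definition peq_sig : signature :=
  Signature (fun f => match f with Sim | Bsim | Meet => 2 | One => 0 end).

Definition sim (X : algebra peq_sig) (a b : X) : X := op X Sim [tuple a; b].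
Definition bsim (X : algebra peq_sig) (a b : X) : X := op X Bsim [tuple a; b].
Definition meet (X : algebra peq_sig) (a b : X) : X := op X Meet [tuple a; b].
Definition top (X : algebra peq_sig) : X := op X One [tuple].
Arguments top {X}.
Definition le (X : algebra peq_sig) (a b : X) : Prop := meet a b = a.

Declare Scope peq_scope.
Delimit Scope peq_scope with PE.
Local Open Scope peq_scope.

Notation "a \sim b" := (sim a b) (at level 50, no associativity) : peq_scope.
Notation "a \bsim b" := (bsim a b) (at level 50, no associativity) : peq_scope.
Notation "a \cap b" := (meet a b) (at level 40, left associativity) : peq_scope.
Notation "a \le b" := (le a b) (at level 70, no associativity) : peq_scope.
Notation "1" := top : peq_scope.

Record pseudo_equality_algebra (X : algebra peq_sig) : Prop := PseudoEquality {
  meetA : associative (@meet X);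
  meetC : commutative (@meet X);
  meetxx : forall a : X, a \cap a = a;
  le1 : forall a : X, a \le 1;
  F2 : forall a : X, a \sim a = 1 /\ a \bsim a = 1;
  F3 : forall a : X, a \sim 1 = a /\ 1 \bsim a = a;
  F4 : forall a b c : X, a \le b -> b \le c ->
    [/\ a \sim c \le b \sim c, a \sim c \le a \sim b,
        c \bsim a \le c \bsim b & c \bsim a \le b \bsim a];
  F5 : forall a b c : X,
    a \sim b \le (a \cap c) \sim (b \cap c) /\
    a \bsim b \le (a \cap c) \bsim (b \cap c);
  F6 : forall a b c : X,
    a \sim b \le (c \sim a) \bsim (c \sim b) /\
    a \bsim b \le (a \bsim c) \sim (b \bsim c);
  F7 : forall a b c : X,
    a \sim b \le (a \sim c) \sim (b \sim c) /\
    a \bsim b \le (c \bsim a) \bsim (c \bsim b) }.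

Section Axiomatization.

Let T := term peq_sig nat.
Let bin (f : symbol peq_sig) (a b : T) : T :=
  App f [ffun i : 'I_(arity f) => nth a [:: a; b] i].
Let s := bin Sim.
Let r := bin Bsim.
Let m := bin Meet.
Let o : T := App (One : symbol peq_sig) (ffun0 (card_ord 0)).
Let leq (a b : T) : identity peq_sig := m a b =~ a.
Let x : T := Var 0.
Let y : T := Var 1%N.
Let z : T := Var 2.
Let yz := m y z.
Let xyz := m x yz.

Inductive peq_axiom : identity peq_sig -> Prop :=
| AxmeetA : peq_axiom (m x (m y z) =~ m (m x y) z)
| AxmeetC : peq_axiom (m x y =~ m y x)
| Axmeetxx : peq_axiom (m x x =~ x)
| Axle1 : peq_axiom (leq x o)
| AxF2s : peq_axiom (s x x =~ o)
| AxF2r : peq_axiom (r x x =~ o)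
| AxF3s : peq_axiom (s x o =~ x)
| AxF3r : peq_axiom (r o x =~ x)
(* (F4) for [x \cap (y \cap z) \le y \cap z \le z], the general form of a
   chain of three elements. *)
| AxF4a : peq_axiom (leq (s xyz z) (s yz z))
| AxF4b : peq_axiom (leq (s xyz z) (s xyz yz))
| AxF4c : peq_axiom (leq (r z xyz) (r z yz))
| AxF4d : peq_axiom (leq (r z xyz) (r yz xyz))
| AxF5s : peq_axiom (leq (s x y) (s (m x z) (m y z)))
| AxF5r : peq_axiom (leq (r x y) (r (m x z) (m y z)))
| AxF6s : peq_axiom (leq (s x y) (r (s z x) (s z y)))
| AxF6r : peq_axiom (leq (r x y) (s (r x z) (r y z)))
| AxF7s : peq_axiom (leq (s x y) (s (s x z) (s y z)))
| AxF7r : peq_axiom (leq (r x y) (r (r z x) (r z y))).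

#[local] Arguments eval : simpl never.

Lemma eval_bin (X : algebra peq_sig) (v : nat -> X) (a b : T) :
  [/\ eval v (s a b) = eval v a \sim eval v b,
      eval v (r a b) = eval v a \bsim eval v b &
      eval v (m a b) = eval v a \cap eval v b].
Proof.
by split; congr (op X _ _); apply: eq_from_tnth => i; rewrite tnth_mktuple ffunE;
  case: i => [[|[|//]]] ?.
Qed.

Lemma eval_o (X : algebra peq_sig) (v : nat -> X) : eval v o = 1.
Proof. by congr (op X _ _); apply: eq_from_tnth => -[]. Qed.

Lemma pseudo_equality_algebraP (X : algebra peq_sig) :
  pseudo_equality_algebra X <-> equational_class peq_axiom X.
Proof.
have Es v a b : eval v (s a b) = sim (eval v a) (eval v b) :> X
  by case: (eval_bin v a b).
have Er v a b : eval v (r a b) = bsim (eval v a) (eval v b) :> X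
  by case: (eval_bin v a b).
have Em v a b : eval v (m a b) = meet (eval v a) (eval v b) :> X
  by case: (eval_bin v a b).
have Ex v : (eval v x = v 0) * (eval v y = v 1%N) * (eval v z = v 2 :> X) by [].
have E := (Es, Er, Em, @eval_o X, Ex).
split=> [[hA hC hI h1 h2 h3 h4 h5 h6 h7] e ax v | h].
  have lel (a b : X) : a \cap b \le b by rewrite /le -hA hI.
  case: ax; rewrite /= /yz /xyz ?E -?/(le _ _);
  by [ apply: hA | apply: hC | apply: hI | apply: h1
     | case: (h2 (v 0)) | case: (h3 (v 0))
     | case: (h4 (v 0 \cap (v 1%N \cap v 2)) (v 1%N \cap v 2) (v 2)
                (lel _ _) (lel _ _))
     | case: (h5 (v 0) (v 1%N) (v 2)) | case: (h6 (v 0) (v 1%N) (v 2))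
     | case: (h7 (v 0) (v 1%N) (v 2)) ].
pose w (a b c : X) := nth a [:: a; b; c].
have H e (ax : peq_axiom e) a b c := h e ax (w a b c).
split.
- by move=> a b c; have := H _ AxmeetA a b c; rewrite /= ?E.
- by move=> a b; have := H _ AxmeetC a b b; rewrite /= ?E.
- by move=> a; have := H _ Axmeetxx a a a; rewrite /= ?E.
- by move=> a; have := H _ Axle1 a a a; rewrite /= ?E.
- by move=> a; have := H _ AxF2s a a a; have := H _ AxF2r a a a; rewrite /= ?E.
- by move=> a; have := H _ AxF3s a a a; have := H _ AxF3r a a a; rewrite /= ?E.
- move=> a b c ab bc.
  have := H _ AxF4a a b c; have := H _ AxF4b a b c.
  have := H _ AxF4c a b c; have := H _ AxF4d a b c.
  by rewrite /= /xyz /yz ?E /= bc ab; split.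
- move=> a b c; have := H _ AxF5s a b c; have := H _ AxF5r a b c.
  by rewrite /= ?E.
- move=> a b c; have := H _ AxF6s a b c; have := H _ AxF6r a b c.
  by rewrite /= ?E.
- move=> a b c; have := H _ AxF7s a b c; have := H _ AxF7r a b c.
  by rewrite /= ?E.
Qed.

End Axiomatization.

Definition pseudo_equality_variety : variety peq_sig :=
  Variety (ex_intro _ peq_axiom pseudo_equality_algebraP).

(* Main.v *)
From mathcomp Require Import all_boot.
Require Import Defs.

Local Open Scope peq_scope.

(** The operation [\sim] is itself a subtraction with respect to the constant
    [1]: (F2) says [a \sim a = 1] and (F3) says [a \sim 1 = a].  So the terms
    [sim_term] and [one_term] witness subtractivity, and [eval_sim] and
    [eval_one] reduce the two identities to these axioms. *)

Definition sim_term : nary_term peq_sig 2 :=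
  App (Sim : symbol peq_sig) [ffun i : 'I_2 => Var i].

Definition one_term : nary_term peq_sig 0 :=
  App (One : symbol peq_sig) (ffun0 (card_ord 0)).

Lemma eval_sim (X : algebra peq_sig) (v : nat -> X) (a b : term peq_sig nat) :
  eval v (tinst sim_term [tuple a; b]) = eval v a \sim eval v b.
Proof.
congr (op X _ _); apply: eq_from_tnth => i; rewrite tnth_mktuple !ffunE /=.
by case: i => [[|[|//]]] ?.
Qed.

Lemma eval_one (X : algebra peq_sig) (v : nat -> X) :
  eval v (tinst one_term [tuple]) = 1.
Proof. by congr (op X _ _); apply: eq_from_tnth => -[]. Qed.

Theorem theorem4p15 : subtractive pseudo_equality_variety.
Proof.
exists sim_term, one_term; split=> X HX v; rewrite [LHS]eval_sim.
- by rewrite [RHS]eval_one; case: (F2 HX (v 0)).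
- by rewrite eval_one; case: (F3 HX (v 0)).
Qed.
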